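(* Let $S$ be a finite set, $d\geq 1$ an integer, and $\Omega=S^{\mathbb{Z}^d}$. Let $\mu$ be an ergodic probability measure on $\Omega$ which satisfies a Gaussian concentration bound. Then $\mu$ has the positive relative entropy property, that is, $h_*(\nu|\mu)>0$ for every ergodic probability measure $\nu\neq\mu$ on $\Omega$.
   Context: $\Omega=S^{\mathbb{Z}^d}$ carries the product topology and its Borel $\sigma$-algebra $\mathfrak{B}$. Shift: $(\theta_x\omega)_y=\omega_{y-x}$ for $x,y\in\mathbb{Z}^d$. A probability measure on $(\Omega,\mathfrak{B})$ is shift-invariant if it is invariant under every $\theta_x$; ''ergodic'' means shift-invariant and trivial on the $\sigma$-algebra of events $A\in\mathfrak{B}$ with $\theta_xA=A$ for all $x\in\mathbb{Z}^d$. $\Lambda_n=\{x\in\mathbb{Z}^d:-n\leq x_i\leq n,\ i=1,\dots,d\}$. For $p_n\in S^{\Lambda_n}$, $[p_n]=\{\omega\in\Omega:\omega_{\Lambda_n}=p_n\}$. For shift-invariant probability measures $\mu,\nu$, $$H_n(\nu|\mu)=\sum_{p_n\in S^{\Lambda_n}}\nu([p_n])\log\frac{\nu([p_n])}{\mu([p_n])}\in[0,+\infty]$$ (usual conventions: a term is $0$ if $\nu([p_n])=0$, and $+\infty$ if $\nu([p_n])>0=\mu([p_n])$), and the lower relative entropy is $h_*(\nu|\mu)=\liminf_{n\to\infty}\frac{H_n(\nu|\mu)}{(2n+1)^d}$. Gaussian concentration bound: a function $F:\Omega\to\mathbb{R}$ is local if it depends only on the coordinates in some finite subset of $\mathbb{Z}^d$.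 For $x\in\mathbb{Z}^d$, $\delta_x(F)=\sup\{|F(\omega)-F(\omega')|:\omega,\omega'\in\Omega \text{ differ only at site } x\}$. A probability measure $\mu$ on $(\Omega,\mathfrak{B})$ satisfies a Gaussian concentration bound if there is a constant $D>0$ such that for every local function $F$, $\mathbb{E}_\mu[\exp(F-\mathbb{E}_\mu(F))]\leq\exp\big(D\sum_{x\in\mathbb{Z}^d}\delta_x(F)^2\big)$. *)

(* Defs.v *)
From HB Require Import structures.
From mathcomp Require Import all_boot all_order all_algebra finmap.
From mathcomp Require Import all_classical all_reals all_analysis.

Set Implicit Arguments.
Unset Strict Implicit.
Unset Printing Implicit Defensive.

Import Order.TTheory GRing.Theory Num.Theory.
Import numFieldNormedType.Exports.

Local Open Scope classical_set_scope.
Local Open Scope ring_scope.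

(* A pointed finite type is the same as a nonempty one; measurable types are
   pointed in MathComp-Analysis, and there is no probability measure on the
   configuration space of an empty alphabet. *)
#[short(type="pointedFinType")]
HB.structure Definition PointedFinite := {S of Finite S & Pointed S}.

Definition config (d : nat) (S : pointedFinType) :=
  {ptws 'rV[int]_d -> discrete_topology S}.

Notation borel_config d S :=
  (g_sigma_algebraType (@open (config d S))).

Section Configurations.
Context {d : nat} {S : pointedFinType}.

Definition shift (x : 'rV[int]_d) (w : borel_config d S) : borel_config d S :=
  fun y => w (y - x).

Definition box (n : nat) : {fset 'rV[int]_d} :=
  fset_set [set x : 'rV[int]_d | forall i, - n%:Z <= x ord0 i <= n%:Z].

(* [fset_set A] is empty when [A] is infinite; the box is finite. *)
Lemma in_box n (x : 'rV[int]_d) :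
  (x \in box n) = [forall i, - n%:Z <= x ord0 i <= n%:Z].
Proof.
rewrite in_fset_set; last first.
  pose f (k : {ffun 'I_d -> 'I_(n + n).+1}) : 'rV[int]_d :=
    \row_i ((k i : nat)%:Z - n%:Z).
  apply: (@sub_finite_set _ _ (f @` [set: _])).
    move=> y yn; exists [ffun i => inord (absz (y ord0 i + n%:Z))] => //.
    apply/rowP => i; rewrite mxE ffunE.
    have := yn i; case/andP => y1 y2.
    have y3 : 0 <= y ord0 i + n%:Z by rewrite -lerBlDr sub0r.
    rewrite inordK; first by rewrite gez0_abs// addrK.
    by rewrite ltnS -lez_nat gez0_abs// PoszD lerD2r.
  exact/finite_image/finite_finset.
by apply/idP/forallP => [/set_mem|h]; [|apply/mem_set].
Qed.

Definition cylinder n (p : {ffun box n -> S}) : set (borel_config d S) :=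
  [set w | forall x : box n, w (val x) = p x].

Definition local_fun (T : Type) (F : borel_config d S -> T) :=
  exists L : {fset 'rV[int]_d}, forall w w' : borel_config d S,
    (forall x, x \in L -> w x = w' x) -> F w = F w'.

Context {R : realType}.

Definition oscillation (x : 'rV[int]_d) (F : borel_config d S -> R) : \bar R :=
  ereal_sup [set e | exists w w' : borel_config d S,
    (forall y, y != x -> w y = w' y) /\ e = `|F w - F w'|%:E].

Implicit Types mu nu : probability (borel_config d S) R.

Definition shift_invariant mu :=
  forall x (A : set (borel_config d S)), measurable A ->
    mu (shift x @^-1` A) = mu A.

Definition ergodic mu :=
  shift_invariant mu /\
  forall A : set (borel_config d S), measurable A ->
    (forall x, shift x @` A = A) -> mu A = 0%E \/ mu A = 1%E.

Definition gaussian_concentration mu :=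
  exists2 D : R, 0 < D &
    forall F : borel_config d S -> R, local_fun F ->
      ('E_mu[fun w => expR (F w - fine 'E_mu[F])] <=
       expeR (D%:E * \esum_(x in [set: 'rV[int]_d]) oscillation x F ^+ 2))%E.

Definition relative_entropy n nu mu : \bar R :=
  (\sum_(p : {ffun box n -> S})
    let a := nu (cylinder p) in
    let b := mu (cylinder p) in
    if a == 0 then 0 else if b == 0 then +oo else a * lne (a / b))%E.

Definition lower_relative_entropy nu mu : \bar R :=
  limn_einf (fun n =>
    relative_entropy n nu mu / (((2 * n + 1) ^ d)%N%:R)%:E)%E.

(* [probability] records a function on all subsets of the space, so two measures
   are distinguished by a measurable set rather than by [<>]. *)
Definition positive_relative_entropy mu :=
  forall nu, ergodic nu ->
    ~ (forall A : set (borel_config d S), measurable A -> nu A = mu A) ->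
    (0 < lower_relative_entropy nu mu)%E.

End Configurations.

(* Main.v *)
(**
If [nu] and [mu] differ, they give different masses to some cylinder [C] over a
box of radius [k].  Let [F = t * sum_x 1_C o shift x], the sum being over the
box of radius [n], and [N = n + k].  By shift invariance, the means of [F] under
[nu] and [mu] differ by [t |box n| (nu C - mu C)].  Changing one site affects at
most [|box k|] terms of [F], so the concentration bound yields
[log E_mu exp (F - E_mu F) <= D t^2 |box k|^2 |box N|], and the Gibbs inequality
[E_nu G <= H_N (nu | mu) + log E_mu exp G] yields
[H_N (nu | mu) >= t |box n| (nu C - mu C) - D t^2 |box k|^2 |box N|].
As [|box n|] is at least a fixed fraction of [|box N|], a small [t] of the sign
of [nu C - mu C] makes the right-hand side at least [c |box N|] with [c > 0].
*)
Require Import Defs.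
From mathcomp Require Import all_boot all_order all_algebra finmap.
From mathcomp Require Import all_classical all_reals all_analysis.
From mathcomp Require Import zify ring lra.

Set Implicit Arguments.
Unset Strict Implicit.
Unset Printing Implicit Defensive.

Import Order.TTheory GRing.Theory Num.Theory.
Import numFieldNormedType.Exports.
(* Restores [shift], which MathComp-Analysis also defines. *)
Import Defs.

Local Open Scope classical_set_scope.
Local Open Scope ring_scope.

(** * Events that depend on finitely many sites *)

Section Windows.
Context {d : nat} {S : pointedFinType}.
Implicit Types (w : borel_config d S) (x : 'rV[int]_d).

Lemma nbhs_agree (w : config d S) (x : 'rV[int]_d) :
  nbhs w [set w' : config d S | w' x = w x].
Proof.
have := @proj_continuous 'rV[int]_d (fun=> discrete_topology S) x w
  [set s | s = w x].
by apply; apply: (@principal_filterP (discrete_topology S) (w x) _).2.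
Qed.

(** Around each of its points, [A] contains a finite intersection of the neighbourhoods of
    [nbhs_agree]. *)
Lemma open_window (L : {fset 'rV[int]_d}) (A : set (config d S)) :
  (forall w w', (forall x, x \in L -> w x = w' x) -> A w -> A w') -> open A.
Proof.
move=> AL; rewrite openE => w Aw.
have : nbhs w (\bigcap_(x in [set` L]) [set w' : config d S | w' x = w x]).
  apply: filter_bigI => x _; exact: nbhs_agree.
by apply: filterS => w' ww'; apply: AL Aw => x xL; rewrite (ww' x).
Qed.

Lemma box_le n m x : (n <= m)%N -> x \in box n -> x \in box m.
Proof.
move=> nm; rewrite !in_box => /forallP xn; apply/forallP => i.
by have := xn i; lia.
Qed.

Lemma box_abs x : x \in box (\max_i `|x ord0 i|)%N.
Proof.
rewrite in_box; apply/forallP => i.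
by have /= := @leq_bigmax _ (fun i => `|x ord0 i|%N) i; lia.
Qed.

(** Equality of patterns is the form in which dependence on [box n] alone is expressed below. *)
Definition pattern n w : {ffun @box d n -> S} := [ffun x => w (val x)].

Lemma cylinder_pattern n w (p : {ffun @box d n -> S}) :
  cylinder p w <-> p = pattern n w.
Proof.
split=> [pw|-> x]; last by rewrite ffunE.
by apply/ffunP => x; rewrite ffunE pw.
Qed.

Lemma eq_pattern n w w' :
  pattern n w = pattern n w' <-> (forall x, x \in box n -> w x = w' x).
Proof.
split=> [/ffunP ww' x xn|ww']; first by have := ww' [` xn]%fset; rewrite !ffunE.
by apply/ffunP => x; rewrite !ffunE ww'// fsvalP.
Qed.

Lemma window_measurable n (A : set (borel_config d S)) :
  (forall w w', pattern n w = pattern n w' -> A w -> A w') -> measurable A.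
Proof.
move=> An; apply: sub_sigma_algebra; apply: (@open_window (box n)) => w w'.
by move/eq_pattern; exact: An.
Qed.

Lemma cylinder_measurable n (p : {ffun @box d n -> S}) : measurable (cylinder p).
Proof.
apply: (@window_measurable n) => w w' ww'.
by rewrite !cylinder_pattern ww'.
Qed.

(** Otherwise each [n] has a configuration outside [A] that agrees with [w] on [box n]. These
    converge pointwise to [w], since every site lies in all large boxes, so they eventually enter
    the open set [A]. *)
Lemma open_cylinder (A : set (config d S)) (w : config d S) : open A -> A w ->
  exists n, cylinder (pattern n w) `<=` A.
Proof.
rewrite openE => Ao Aw; apply: contrapT => /forallNP noA.
have /choice[u uP] : forall n, exists w' : config d S,
    pattern n w' = pattern n w /\ ~ A w'.
  move=> n; have /existsNP[w' /not_implyP[w'n Aw']] := noA n.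
  by exists w'; split => //; apply/esym/cylinder_pattern.
have : {ptws, u n @[n --> \oo] --> w}.
  apply: (@pointwise_cvgP (discrete_topology 'rV[int]_d) (discrete_topology S)
    (u @ \oo) w _).2 => x.
  apply: cvg_near_cst; have : \forall n \near \oo, u n x = w x; last by [].
  near=> n; have [/eq_pattern -> //] := uP n.
  apply: box_le (box_abs x); near: n; exact: nbhs_infty_ge.
move=> /(_ _ (Ao _ Aw)) [N _ /(_ N (leqnn N))].
by case: (uP N).
Unshelve. all: end_near. Qed.

End Windows.

(** * Cylinders determine a probability measure *)

Section Separation.
Context {d : nat} {S : pointedFinType} {R : realType}.

(** [set0] makes the family closed under intersection, and [setT] provides the covering sequence for
    [measure_unique]. *)
Definition cylinders : set (set (borel_config d S)) :=
  [set A | [\/ A = set0, A = setT |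
    exists n (p : {ffun @box d n -> S}), A = cylinder p]].

Lemma cylinderI n m (p : {ffun @box d n -> S}) (q : {ffun @box d m -> S}) :
  (n <= m)%N -> cylinders (cylinder p `&` cylinder q).
Proof.
move=> nm; have [[w [pw qw]]|/forallNP pq0] :=
  pselect (exists w, (cylinder p `&` cylinder q) w); last first.
  by apply: Or31; apply/seteqP; split=> [w /pq0|].
apply: Or33; exists m, q; apply/seteqP; split=> [w' []//|w' qw'].
split=> //; move: pw qw qw'; rewrite !cylinder_pattern => -> -> /eq_pattern ww'.
by apply/eq_pattern => x /(box_le nm) /ww'.
Qed.

Lemma setI_closed_cylinders : setI_closed cylinders.
Proof.
move=> A B [->|->|[n [p ->]]]; first by rewrite set0I => _; exact: Or31.
  by rewrite setTI.
move=> [->|->|[m [q ->]]]; first by rewrite setI0; exact: Or31.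
  by rewrite setIT; apply: Or33; exists n, p.
have [nm|/ltnW mn] := leqP n m; first exact: cylinderI.
by rewrite setIC; exact: cylinderI.
Qed.

(** An open set is the union of the cylinders inside it. This union is countable, because each box
    carries finitely many patterns. *)
Lemma measurable_cylinders :
  @measurable _ (borel_config d S) = <<s cylinders >>.
Proof.
apply/seteqP; split; last first.
  apply: smallest_sub; first exact: sigma_algebra_measurable.
  move=> _ [->|->|[n [p ->]]] //; exact: cylinder_measurable.
apply: smallest_sub; first exact: smallest_sigma_algebra.
move=> A Ao; pose W n : set {ffun @box d n -> S} := [set p | cylinder p `<=` A].
have -> : A = \bigcup_n \bigcup_(p in W n) cylinder p.
  apply/seteqP; split=> [w /(open_cylinder Ao)[n nA]|w [n _ [p pA]]]; last exact: pA.
  by exists n => //; exists (pattern n w) => //; exact/cylinder_pattern.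
apply: (@bigcupT_measurable _ (g_sigma_algebraType cylinders)) => n.
apply: (@fin_bigcup_measurable _ (g_sigma_algebraType cylinders)).
  exact: finite_finset.
by move=> p _; apply: sub_sigma_algebra; apply: Or33; exists n, p.
Qed.

Lemma eq_cylinders (mu nu : probability (borel_config d S) R) :
  (forall n (p : {ffun @box d n -> S}), nu (cylinder p) = mu (cylinder p)) ->
  forall A, measurable A -> nu A = mu A.
Proof.
move=> munu; apply: (measure_unique cylinders (fun=> setT)).
- exact: measurable_cylinders.
- exact: setI_closed_cylinders.
- by move=> _; exact: Or32.
- by rewrite bigcup_const.
- move=> _ [->|->|[n [p ->]]]; [by rewrite !measure0| |exact: munu].
  exact: etrans (probability_setT nu) (esym (probability_setT mu)).
- move=> _; apply: le_lt_trans (ltry 1); exact: probability_le1.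
Qed.

End Separation.

(** * Expectation of a finite combination of indicators *)

Section Expectation.
Context {R : realType} {dp : measure_display} {T : measurableType dp}.
Variable P : probability T R.

Lemma expectation_indic_sum (I : finType) (c : I -> R) (A : I -> set T) :
  (forall i, measurable (A i)) ->
  ('E_P[fun w => (\sum_i c i * \1_(A i) w)%R] =
   (\sum_i c i * fine (P (A i)))%R%:E)%E.
Proof.
move=> mA; rewrite unlock.
under eq_integral do rewrite -sumEFin.
have iA i : P.-integrable setT (fun w => (\1_(A i) w)%:E) by exact: integrable_indic.
rewrite integral_sum//; last first.
  by move=> i; under eq_fun do rewrite EFinM; exact: integrableZl.
rewrite -(sumEFin _ xpredT); apply: eq_bigr => i _.
under eq_integral do rewrite EFinM.
rewrite integralZl// integral_indic// setIT EFinM fineK//.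
exact: fin_num_measure.
Qed.

End Expectation.

(** * The Gibbs inequality on a box *)

Section Gibbs.
Context {d : nat} {S : pointedFinType} {R : realType}.
Implicit Types P mu nu : probability (borel_config d S) R.

(** The value [point] off the box is arbitrary: [extend p] serves as a representative of the
    cylinder of [p]. *)
Definition extend n (p : {ffun @box d n -> S}) : borel_config d S :=
  fun y => if insub y is Some y' then p y' else point.

Lemma extendK n : cancel (@extend n) (pattern n).
Proof. by move=> p; apply/ffunP => x; rewrite ffunE /extend valK. Qed.

(** The cylinders over [box n] partition the space, and [h] is constant on each of them. *)
Lemma expectation_window P n (h : borel_config d S -> R) :
  (forall w w', pattern n w = pattern n w' -> h w = h w') ->
  ('E_P[h] = (\sum_(p : {ffun @box d n -> S})
    h (extend p) * fine (P (cylinder p)))%R%:E)%E.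
Proof.
move=> hn; rewrite -expectation_indic_sum; last exact: cylinder_measurable.
congr expectation; apply/funext => w.
rewrite (bigD1 (pattern n w))//= big1 ?addr0 => [|p pw].
  rewrite indicE mem_set ?mulr1; last exact/cylinder_pattern.
  by apply: hn; rewrite extendK.
rewrite indicE memNset ?mulr0// => /cylinder_pattern wp.
by rewrite wp eqxx in pw.
Qed.

Lemma sum_cylinder P n :
  \sum_(p : {ffun @box d n -> S}) fine (P (cylinder p)) = 1.
Proof.
have := @expectation_window P n (cst 1) (fun _ _ _ => erefl).
rewrite expectation_cst => -[->].
by apply: eq_bigr => p _; rewrite mul1r.
Qed.

(** The logarithmic inequality is applied for each [i], weighted by [a i] and summed. The factor
    [expR (- K)] makes the sum of the right-hand sides at most [1 - 1 = 0]. *)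
Lemma gibbs_finite (I : finType) (a b f : I -> R) (m K : R) :
  (forall i, 0 <= a i) -> (forall i, 0 <= b i) ->
  (forall i, b i = 0 -> a i = 0) -> \sum_i a i = 1 ->
  \sum_i expR (f i - m) * b i <= expR K ->
  \sum_i f i * a i <= \sum_i a i * ln (a i / b i) + (m + K).
Proof.
move=> a0 b0 ba a1 bK.
have H i : f i * a i - a i * ln (a i / b i) - (m + K) * a i <=
    expR (- K) * (expR (f i - m) * b i) - a i.
  have [ai0|ai_neq0] := eqVneq (a i) 0.
    by rewrite ai0 !(mul0r,mulr0,subr0) !mulr_ge0// expR_ge0.
  have ai : 0 < a i by rewrite lt_def ai_neq0 a0.
  have bi : 0 < b i.
    by rewrite lt_def b0 andbT; apply: contraNneq ai_neq0 => /ba ->.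
  have t0 : 0 < expR (f i - m - K) * (b i / a i).
    by rewrite mulr_gt0 ?expR_gt0// divr_gt0.
  (* [ln u <= u - 1] at [u = expR (f i - m - K) * b i / a i] *)
  have := @le_ln1Dx R (expR (f i - m - K) * (b i / a i) - 1).
  rewrite ltrBrDl subrr => /(_ t0).
  rewrite addrC subrK lnM ?posrE ?expR_gt0 ?divr_gt0// expRK.
  rewrite -[b i / a i]invf_div lnV ?posrE ?divr_gt0// invf_div.
  rewrite -(ler_pM2l ai) [_ * (_ - 1)]mulrBr mulr1.
  have -> : a i * (expR (f i - m - K) * (b i / a i)) =
      expR (- K) * (expR (f i - m) * b i) by rewrite expRD; field.
  lra.
have : \sum_i _ <= \sum_i _ := ler_sum _ (fun i _ => H i).
rewrite !sumrB -!mulr_sumr a1.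
have : expR (- K) * (\sum_i expR (f i - m) * b i) <= 1.
  by rewrite -(expRxMexpNx_1 K) mulrC ler_wpM2r// expR_ge0.
lra.
Qed.

Lemma cylinder_fin_num P n (p : {ffun @box d n -> S}) :
  P (cylinder p) \is a fin_num.
Proof. by apply: fin_num_measure; exact: cylinder_measurable. Qed.

Lemma relative_entropy_term mu nu n (p : {ffun @box d n -> S}) :
  nu (cylinder p) != 0%E -> mu (cylinder p) != 0%E ->
  (nu (cylinder p) * lne (nu (cylinder p) / mu (cylinder p)) =
   (fine (nu (cylinder p)) *
     ln (fine (nu (cylinder p)) / fine (mu (cylinder p))))%R%:E)%E.
Proof.
have gt0 P : P (cylinder p) != 0%E -> 0 < fine (P (cylinder p)).
  move=> P0; rewrite fine_gt0// lt_def P0 measure_ge0 -ge0_fin_numE//.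
  exact: cylinder_fin_num.
have fin P : P (cylinder p) = (fine (P (cylinder p)))%:E.
  by rewrite fineK// cylinder_fin_num.
move=> /gt0 nup /gt0 mup.
rewrite [in LHS](fin nu) [in LHS](fin mu) inver gt_eqF// -EFinM lne_EFin//.
by rewrite divr_gt0.
Qed.

Lemma gibbs mu nu n (F : borel_config d S -> R) (m K : R) :
  (forall w w', pattern n w = pattern n w' -> F w = F w') ->
  ('E_mu[fun w => expR (F w - m)] <= (expR K)%:E ->
  'E_nu[F] <= relative_entropy n nu mu + (m + K)%:E)%E.
Proof.
move=> Fn; rewrite (expectation_window _ Fn) (@expectation_window mu n); last first.
  by move=> w w' /Fn ->.
rewrite lee_fin => FK.
have fin P (p : {ffun @box d n -> S}) : P (cylinder p) = (fine (P (cylinder p)))%:E.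
  by rewrite fineK// cylinder_fin_num.
have [/existsP[p /andP[nup /eqP mup]]|/existsPn munu] :=
    boolP [exists p : {ffun @box d n -> S},
      (nu (cylinder p) != 0%E) && (mu (cylinder p) == 0%E)].
  suff -> : relative_entropy n nu mu = +oo%E by rewrite addye// leey.
  apply/eqP; rewrite /relative_entropy esum_eqy.
    by apply/existsP; exists p; rewrite (negbTE nup) mup !eqxx.
  (* An infinite term makes the sum [+oo] once no term is [-oo]; a term with both masses nonzero is
     real. *)
  move=> q _ /=; case: ifPn => // nq; case: ifPn => // mq.
  by rewrite relative_entropy_term.
have -> : relative_entropy n nu mu =
   (\sum_(p : {ffun @box d n -> S}) fine (nu (cylinder p)) *
    ln (fine (nu (cylinder p)) / fine (mu (cylinder p))))%R%:E.
  rewrite -(sumEFin _ xpredT); apply: eq_bigr => p _ /=.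
  have [nup|nup] := eqVneq (nu (cylinder p)) 0%E; first by rewrite nup mul0r.
  have := munu p; rewrite nup/= => mup.
  by rewrite (negbTE mup) relative_entropy_term.
rewrite -EFinD lee_fin; apply: gibbs_finite FK.
- by move=> p; exact: fine_ge0.
- by move=> p; exact: fine_ge0.
- move=> p mup; have := munu p; rewrite negb_and negbK [mu _]fin mup eqxx orbF.
  by move=> /eqP ->.
- exact: sum_cylinder.
Qed.

End Gibbs.

(** * Counting the occurrences of a pattern: mean and oscillations *)

Section Occupation.
Context {d : nat} {S : pointedFinType} {R : realType}.
Implicit Types (mu nu : probability (borel_config d S) R).
Implicit Types (w : borel_config d S) (x y z : 'rV[int]_d).

Lemma card_box n : #|` @box d n| = ((2 * n + 1) ^ d)%N.
Proof.
pose f (k : {ffun 'I_d -> 'I_(2 * n).+1}) : 'rV[int]_d :=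
  \row_i ((k i : nat)%:Z - n%:Z).
have f_inj : injective f.
  move=> k l /rowP kl; apply/ffunP => i; apply: val_inj => /=.
  by have := kl i; rewrite !mxE; lia.
have -> : box n = [fset f k | k : {ffun 'I_d -> 'I_(2 * n).+1}]%fset.
  apply/fsetP => x; rewrite in_box; apply/forallP/imfsetP => [xn|[k _ ->] i].
    exists [ffun i => inord (absz (x 0 i + n%:Z))] => //.
    apply/rowP => i; have xni : - n%:Z <= x 0 i <= n%:Z := xn i.
    by rewrite mxE ffunE inordK; lia.
  by rewrite mxE lerBrDr addNr lerBlDr -PoszD !lez_nat leq0n -ltnS addnn -mul2n ltn_ord.
by rewrite card_imfset//= -cardE card_ffun !card_ord addn1.
Qed.

Lemma boxB n k x y : x \in box n -> y \in box k -> y - x \in box (n + k).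
Proof.
rewrite !in_box => /forallP xn /forallP yk; apply/forallP => i.
have := xn i; have := yk i; rewrite !mxE.
by move: (x ord0 i) (y ord0 i) => a b; lia.
Qed.

Lemma card_box_translate n k z :
  (#|[pred x : @box d n | (val x + z)%R \in box k]| <= #|` @box d k|)%N.
Proof.
rewrite cardE -(size_map (fun x : @box d n => val x + z)); apply: uniq_leq_size.
  by rewrite map_inj_uniq ?enum_uniq// => x y /addIr /val_inj.
by move=> _ /mapP[x + ->]; rewrite mem_enum.
Qed.

Lemma card_box_translate0 n k z : z \notin box (n + k) ->
  #|[pred x : @box d n | (val x + z) \in box k]| = 0%N.
Proof.
move=> znk; apply: eq_card0 => x; rewrite !inE; apply: contraNF znk.
by move/(boxB (fsvalP x)); rewrite addrC addKr.
Qed.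

Variables (k : nat) (q : {ffun @box d k -> S}).

(** This is the [F] of the overview; [t] stands inside the sum to fit [expectation_indic_sum]. *)
Definition occupation n (t : R) (w : borel_config d S) : R :=
  \sum_(x : @box d n) t * \1_(shift (val x) @^-1` cylinder q) w.

Lemma pattern_shift n x w w' : x \in box n ->
  pattern (n + k) w = pattern (n + k) w' ->
  pattern k (shift x w) = pattern k (shift x w').
Proof.
move=> xn /eq_pattern ww'; apply/eq_pattern => y yk; exact/ww'/boxB.
Qed.

Lemma indic_shift_cylinder x w w' :
  pattern k (shift x w) = pattern k (shift x w') ->
  \1_(shift x @^-1` cylinder q) w = \1_(shift x @^-1` cylinder q) w' :> R.
Proof.
move=> ww'; rewrite !indicE; congr (_%:R); congr nat_of_bool.
by apply/idP/idP => /set_mem/cylinder_pattern qw; apply/mem_set/cylinder_pattern;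
  rewrite qw.
Qed.

Lemma occupation_pattern n t w w' :
  pattern (n + k) w = pattern (n + k) w' -> occupation n t w = occupation n t w'.
Proof.
move=> ww'; apply: eq_bigr => x _; congr (_ * _).
exact/indic_shift_cylinder/(pattern_shift (fsvalP x)).
Qed.

Lemma occupation_local n t : local_fun (occupation n t).
Proof.
by exists (box (n + k)) => w w' ww'; apply/occupation_pattern/eq_pattern.
Qed.

(** The event depends only on a box of radius [k] plus the sup norm of [x]. *)
Lemma measurable_shift_cylinder x : measurable (shift x @^-1` cylinder q).
Proof.
have xn := box_abs x; apply: (window_measurable _) => w w'.
  by move=> /(pattern_shift xn) ww' /=; rewrite !cylinder_pattern ww'.
Qed.

Lemma expectation_occupation mu n t : shift_invariant mu ->
  ('E_mu[occupation n t] =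
   (t * (#|` @box d n|)%:R * fine (mu (cylinder q)))%R%:E)%E.
Proof.
move=> mu_inv; rewrite expectation_indic_sum; last first.
  by move=> x; exact: measurable_shift_cylinder.
rewrite (eq_bigr (fun=> t * fine (mu (cylinder q)))) => [|x _]; last first.
  by rewrite mu_inv//; exact: cylinder_measurable.
by rewrite sumr_const -cardfE mulrAC mulr_natr.
Qed.

(** Terms that do not read [z] cancel in the difference; each other term changes by at most
    [|t|]. *)
Lemma oscillation_occupation n t z :
  (oscillation z (occupation n t) <=
   (`|t| * #|[pred x : @box d n | (val x + z) \in box k]|%:R)%:E)%E.
Proof.
apply: ge_ereal_sup => _ [w [w' [ww' ->]]]; rewrite lee_fin -sumrB.
apply: le_trans (ler_norm_sum _ _ _) _.
rewrite -sum1_card natr_sum mulr_sumr [leRHS]big_mkcond/=.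
apply: ler_sum => x _; rewrite inE; case: ifPn => xz.
  rewrite -mulrBr normrM ler_wpM2l//= !indicE.
  by do 2!case: (_ \in _); rewrite ?subrr ?subr0 ?sub0r ?normrN ?normr1 ?normr0.
rewrite (@indic_shift_cylinder _ w w') ?subrr ?normr0//.
apply/eq_pattern => y yk; apply: ww'; apply: contraNneq xz => <-.
by rewrite addrC subrK.
Qed.

Lemma oscillation_ge0 z (F : borel_config d S -> R) : (0 <= oscillation z F)%E.
Proof.
apply: ereal_sup_ubound; exists point, point; split=> //.
by rewrite subrr normr0.
Qed.

(** Each site of [box (n + k)] contributes at most [(t * |box k|) ^ 2], and no term of the count
    reads a site outside. *)
Lemma sum_oscillation_occupation n t :
  (\esum_(z in [set: 'rV[int]_d]) oscillation z (occupation n t) ^+ 2 <=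
   ((t * #|` @box d k|%:R) ^+ 2 * #|` @box d (n + k)|%:R)%:E)%E.
Proof.
set c := t * _.
apply: (@le_trans _ _ (\esum_(z in [set` @box d (n + k)]) (c ^+ 2)%:E)%E).
  rewrite [leRHS]esum_mkcond; apply: le_esum => z _.
  have osc := oscillation_occupation n t z.
  have osc0 := oscillation_ge0 z (occupation n t).
  case: ifPn => [_|/negP zb].
    rewrite -[c ^+ 2]real_normK ?num_real// normrM normr_nat EFin_expe lee_sqr//.
    apply: le_trans osc _; rewrite lee_fin ler_wpM2l// ler_nat.
    exact: card_box_translate.
  have znk : z \notin box (n + k) by apply/negP => znk; apply/zb/mem_set.
  move: osc; rewrite (card_box_translate0 znk) mulr0 => osc.
  by rewrite (@le_anti _ _ (oscillation _ _) 0%E) ?osc ?osc0// expe2 mul0e.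
rewrite esum_fset// => [|z _]; last by rewrite lee_fin sqr_ge0.
rewrite fsbig_finite// set_fsetK sumEFin big_const_seq count_predT.
by rewrite iter_addr_0 mulr_natr.
Qed.

End Occupation.

(** * Lower bound on the relative entropy per site *)

Lemma limn_einf_ge (R : realType) (u : nat -> \bar R) (c : \bar R) (N : nat) :
  (forall n, (N <= n)%N -> (c <= u n)%E) -> (c <= limn_einf u)%E.
Proof.
move=> uc; rewrite limn_einf_lim; apply: lime_ge; first exact: is_cvg_einfs.
exists N => // n /= Nn; apply: le_ereal_inf_tmp => _ [m /= nm <-].
exact/uc/(leq_trans Nn).
Qed.

Section LowerBound.
Context {d : nat} {S : pointedFinType} {R : realType}.
Variables mu nu : probability (borel_config d S) R.
Hypotheses (mu_inv : shift_invariant mu) (nu_inv : shift_invariant nu).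

(** This is [gibbs] for [occupation q n t], with [m] its mean under [mu] and [K] the bound on the
    concentration exponent. *)
Lemma relative_entropy_ge (D : R) n k (q : {ffun @box d k -> S}) (t : R) :
  0 < D ->
  (forall F : borel_config d S -> R, local_fun F ->
    'E_mu[fun w => expR (F w - fine 'E_mu[F])] <=
    expeR (D%:E * \esum_(x in [set: 'rV[int]_d]) oscillation x F ^+ 2))%E ->
  ((t * #|` @box d n|%:R * (fine (nu (cylinder q)) - fine (mu (cylinder q))) -
    D * ((t * #|` @box d k|%:R) ^+ 2 * #|` @box d (n + k)|%:R))%:E <=
   relative_entropy (n + k) nu mu)%E.
Proof.
move=> D0 /(_ _ (occupation_local q n t)); rewrite expectation_occupation//=.
set m := _ * _ * _; set K := D * _ => gcb.
have {}gcb : ('E_mu[fun w => expR (occupation q n t w - m)] <= (expR K)%:E)%E.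
  apply: le_trans gcb _; rewrite -[(expR K)%:E]/(expeR K%:E) lee_expeR EFinM.
  by apply: lee_wpmul2l (sum_oscillation_occupation q n t); rewrite lee_fin ltW.
have := gibbs nu (@occupation_pattern _ _ _ _ q n t) gcb.
by rewrite expectation_occupation// -leeBlDr// -EFinB mulrBr opprD addrA.
Qed.

(** For [k <= n] the side [2 * (n + k) + 1] is at most twice [2 * n + 1]. *)
Lemma card_box_le n k : (k <= n)%N ->
  (#|` @box d (n + k)| <= 2 ^ d * #|` @box d n|)%N.
Proof.
move=> kn; rewrite !card_box -expnMn; have [->|d0] := posnP d; first by [].
by rewrite leq_exp2r//; lia.
Qed.

Lemma lower_relative_entropy_gt0 k (q : {ffun @box d k -> S}) :
  gaussian_concentration mu -> nu (cylinder q) <> mu (cylinder q) ->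
  (0 < lower_relative_entropy nu mu)%E.
Proof.
move=> [D D0 gcb] nuq.
pose v := fine (nu (cylinder q)) - fine (mu (cylinder q)).
have v2 : 0 < v ^+ 2.
  rewrite exprn_even_gt0//= subr_eq0; apply/eqP => nuqE; apply: nuq.
  by rewrite -(fineK (cylinder_fin_num nu q)) nuqE fineK// cylinder_fin_num.
have card0 n : 0 < #|` @box d n|%:R :> R by rewrite card_box ltr0n expn_gt0 addn1.
pose M : R := #|` @box d k|%:R; pose A : R := 2 ^+ d.
have A0 : 0 < A by rewrite exprn_gt0.
(* [c] is the maximum over [t] of [t * v / A - D * (t * M) ^+ 2], reached at
     this [t] *)
pose t := v / (2 * A * D * M ^+ 2).
pose c := v ^+ 2 / (4 * A ^+ 2 * D * M ^+ 2).
have c0 : 0 < c by rewrite divr_gt0// !mulr_gt0// ?exprn_gt0// card0.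
apply: (@lt_le_trans _ _ c%:E); first by rewrite lte_fin.
(* From [2 * k <= N] follows [k <= N - k], as [card_box_le] requires for [n = N - k]. *)
apply: (@limn_einf_ge _ _ _ (2 * k)) => N kN.
pose n := (N - k)%N; have -> : N = (n + k)%N by rewrite subnK//; lia.
rewrite inver -card_box gt_eqF// lee_pdivlMr// -EFinM.
apply: le_trans (relative_entropy_ge n q t D0 gcb); rewrite lee_fin.
have nk : #|` @box d (n + k)|%:R <= A * #|` @box d n|%:R.
  by rewrite /A -natrX -natrM ler_nat card_box_le//; lia.
rewrite -/v -/M.
set L := #|` box n|%:R; set L' := #|` box (n + k)|%:R.
have M0 : 0 < M := card0 k.
(* The gain is [2 * c * (A * L)] and the cost [c * L']; since [L' <= A * L], at least [c * L']
   remains. *)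
have -> : t * L * v = 2 * c * (A * L) by rewrite /t /c; field; rewrite !gt_eqF.
have -> : D * ((t * M) ^+ 2 * L') = c * L' by rewrite /t /c; field; rewrite !gt_eqF.
have := ler_wpM2l (ltW c0) nk; lra.
Qed.

End LowerBound.

Theorem theorem4p1 (R : realType) (S : pointedFinType) (d : nat)
  (hd : (1 <= d)%N) (mu : probability (borel_config d S) R)
  (mu_ergodic : ergodic mu) (mu_gcb : gaussian_concentration mu) :
  positive_relative_entropy mu.
Proof.
move=> nu [nu_inv _] numu.
have [k [q nuq]] : exists k (q : {ffun @box d k -> S}),
    nu (cylinder q) <> mu (cylinder q).
  apply: contrapT => /forallNP nuq; apply: numu; apply: eq_cylinders => k q.
  by apply: contrapT => kq; apply: (nuq k); exists q.
exact: (lower_relative_entropy_gt0 (proj1 mu_ergodic) nu_inv mu_gcb nuq).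
Qed.
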